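(* Consider the horizontal system $$\dot x=h_2,\qquad \dot y=\theta h_2,\qquad \dot\theta=h_1$$ for real functions $x,y,\theta$ of $t$, where $(h_1,h_2,h_3)$ is a solution of $\dot h_1=-h_3h_2$, $\dot h_2=h_3h_1$, $\dot h_3=0$. In the case $h_3\ne0$, with $h_1=C_2\sin(C_1t)+C_3\cos(C_1t)$, $h_2=C_3\sin(C_1t)-C_2\cos(C_1t)$, $h_3=C_1\neq 0$ for constants $C_1,C_2,C_3$, the horizontal system has solutions satisfying $x(0)=y(0)=\theta(0)=0$ given by $$x=\frac1{C_1}\bigl(C_3-C_2\sin(C_1t)-C_3\cos(C_1t)\bigr),$$ $$y=\frac1{4C_1^2}\bigl(2C_1(C_2^2+C_3^2)t-4C_2C_3\cos(C_1t)+2C_2C_3\cos(2C_1t)-4C_2^2\sin(C_1t)+(C_2^2-C_3^2)\sin(2C_1t)+2C_2C_3\bigr),$$ $$\theta=\frac1{C_1}\bigl(C_2-C_2\cos(C_1t)+C_3\sin(C_1t)\bigr).$$ In the degenerate case $h_3=0$, with $h_1=C_1$, $h_2=C_2$ for constants $C_1,C_2$, the solution is $x=C_2t$, $y=\frac12C_2C_1t^2$, $\theta=C_1t$.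
   Context: All constants are real. *)

(* Defs.v *)
From Stdlib Require Import Reals.
From Coquelicot Require Import Coquelicot.
Open Scope R_scope.

Definition vertical_system (h1 h2 h3 : R -> R) : Prop :=
  forall t : R,
    is_derive h1 t (- h3 t * h2 t) /\
    is_derive h2 t (h3 t * h1 t) /\
    is_derive h3 t 0.

Definition horizontal_system (h1 h2 x y theta : R -> R) : Prop :=
  forall t : R,
    is_derive x t (h2 t) /\
    is_derive y t (theta t * h2 t) /\
    is_derive theta t (h1 t).

Definition starts_at_origin (x y theta : R -> R) : Prop :=
  x 0 = 0 /\ y 0 = 0 /\ theta 0 = 0.

(* Main.v *)
Require Import Defs.
From Stdlib Require Import Reals Lra.
From Coquelicot Require Import Coquelicot.
Open Scope R_scope.

(** The horizontal system is triangular: once [h1] and [h2] are given, [x] and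
    [theta] are primitives of known functions, and then [y] is a primitive of
    [theta * h2].  A primitive is determined by its value at [0], so there is
    exactly one solution starting at the origin, and it is enough to exhibit
    one ([horizontal_solution_iff]).  Differentiating the proposed formulas
    shows that they solve the system.  The only point where this is more than a
    cancellation is [y]: the terms of frequency [2 * C1] are those of the product
    [theta * h2], linearized by the double angle formulas, and the linear
    term comes from the mean value [(C2 ^ 2 + C3 ^ 2) / (2 * C1)] of that
    product. *)

Lemma is_derive_unique_primitive (f g df : R -> R) (a : R) :
  (forall t, is_derive f t (df t)) ->
  (forall t, is_derive g t (df t)) ->
  f a = g a ->
  forall t, f t = g t.
Proof.
  intros Hf Hg Ha t.
  assert (Hd : forall s, is_derive (fun u => f u - g u) s 0).
  { intros s.
    replace 0 with (df s - df s) by ring.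
    exact (is_derive_minus f g s (df s) (df s) (Hf s) (Hg s)). }
  (* A function with zero derivative is constant between [a] and [t],
     in whichever order they come. *)
  destruct (Rtotal_order a t) as [Hlt | [<- | Hgt]]; [ | exact Ha | ].
  - pose proof (eq_is_derive _ a t (fun s _ => Hd s) Hlt) as E.
    simpl in E; lra.
  - pose proof (eq_is_derive _ t a (fun s _ => Hd s) Hgt) as E.
    simpl in E; lra.
Qed.

(** Uniqueness for [y] has to come last: its right-hand side involves [theta],
    so two solutions have the same [y'] only once their [theta] agree. *)
Lemma horizontal_solution_unique (h1 h2 x y theta x' y' theta' : R -> R) :
  horizontal_system h1 h2 x y theta ->
  starts_at_origin x y theta ->
  horizontal_system h1 h2 x' y' theta' ->
  starts_at_origin x' y' theta' ->
  forall t, x t = x' t /\ y t = y' t /\ theta t = theta' t.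
Proof.
  intros H [Hx0 [Hy0 Hth0]] H' [Hx0' [Hy0' Hth0']].
  assert (Eth : forall t, theta t = theta' t).
  { apply (is_derive_unique_primitive _ _ h1 0);
      [ apply H | apply H' | congruence ]. }
  assert (Ex : forall t, x t = x' t).
  { apply (is_derive_unique_primitive _ _ h2 0);
      [ apply H | apply H' | congruence ]. }
  assert (Ey : forall t, y t = y' t).
  { apply (is_derive_unique_primitive _ _ (fun t => theta t * h2 t) 0).
    - apply H.
    - intros t; rewrite Eth; apply H'.
    - congruence. }
  auto.
Qed.

(** Reduces the description of all solutions starting at the origin to the
    verification of a single explicit one. *)
Lemma horizontal_solution_iff (h1 h2 X Y Theta : R -> R) :
  horizontal_system h1 h2 X Y Theta ->
  starts_at_origin X Y Theta ->
  forall x y theta : R -> R,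
    (horizontal_system h1 h2 x y theta /\ starts_at_origin x y theta) <->
    (forall t, x t = X t /\ y t = Y t /\ theta t = Theta t).
Proof.
  intros HS H0 x y theta; split.
  - intros [Hs Hs0]; eapply horizontal_solution_unique; eauto.
  - intros E; split.
    + assert (Ex : forall t, X t = x t) by (intros t; symmetry; apply E).
      assert (Ey : forall t, Y t = y t) by (intros t; symmetry; apply E).
      assert (Eth : forall t, Theta t = theta t)
        by (intros t; symmetry; apply E).
      intros t; rewrite <- Eth; destruct (HS t) as [Hx [Hy Hth]].
      split; [ | split ].
      * exact (is_derive_ext X x t _ Ex Hx).
      * exact (is_derive_ext Y y t _ Ey Hy).
      * exact (is_derive_ext Theta theta t _ Eth Hth).
    + unfold starts_at_origin; destruct (E 0) as [-> [-> ->]]; exact H0.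
Qed.

Theorem proposition3p8 :
  (forall C1 C2 C3 : R, C1 <> 0 ->
    let h1 := fun t : R => C2 * sin (C1 * t) + C3 * cos (C1 * t) in
    let h2 := fun t : R => C3 * sin (C1 * t) - C2 * cos (C1 * t) in
    let h3 := fun _ : R => C1 in
    vertical_system h1 h2 h3 /\
    forall x y theta : R -> R,
      (horizontal_system h1 h2 x y theta /\ starts_at_origin x y theta) <->
      (forall t : R,
        x t = 1 / C1 * (C3 - C2 * sin (C1 * t) - C3 * cos (C1 * t)) /\
        y t = 1 / (4 * C1 ^ 2) *
              (2 * C1 * (C2 ^ 2 + C3 ^ 2) * t
               - 4 * C2 * C3 * cos (C1 * t)
               + 2 * C2 * C3 * cos (2 * C1 * t)
               - 4 * C2 ^ 2 * sin (C1 * t)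
               + (C2 ^ 2 - C3 ^ 2) * sin (2 * C1 * t)
               + 2 * C2 * C3) /\
        theta t = 1 / C1 * (C2 - C2 * cos (C1 * t) + C3 * sin (C1 * t))))
  /\
  (forall C1 C2 : R,
    let h1 := fun _ : R => C1 in
    let h2 := fun _ : R => C2 in
    let h3 := fun _ : R => 0 in
    vertical_system h1 h2 h3 /\
    forall x y theta : R -> R,
      (horizontal_system h1 h2 x y theta /\ starts_at_origin x y theta) <->
      (forall t : R,
        x t = C2 * t /\
        y t = 1 / 2 * C2 * C1 * t ^ 2 /\
        theta t = C1 * t)).
Proof.
  split.
  - intros C1 C2 C3 HC1 h1 h2 h3; split.
    + unfold h1, h2, h3; intros t.
      split; [ | split ]; auto_derive; trivial; ring.
    + apply horizontal_solution_iff.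
      * unfold h1, h2; intros t.
        split; [ | split ]; auto_derive; trivial; try (field; exact HC1).
        (* The double angle formulas turn the derivative of [y] into a
           polynomial in [sin (C1 * t)] and [cos (C1 * t)].  The constant
           [C2 ^ 2 + C3 ^ 2], which comes from the linear term, is made
           homogeneous of degree two in them: the two sides then agree as
           polynomials. *)
        rewrite !(Rmult_assoc 2 C1 t), sin_2a, cos_2a.
        assert (P : C2 ^ 2 + C3 ^ 2
          = (C2 ^ 2 + C3 ^ 2) * (sin (C1 * t) ^ 2 + cos (C1 * t) ^ 2)).
        { rewrite <- !Rsqr_pow2, sin2_cos2; ring. }
        replace (C2 * (C2 * 1)) with (C2 ^ 2) by ring.
        replace (C3 * (C3 * 1)) with (C3 ^ 2) by ring.
        rewrite P.
        field; exact HC1.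
      * unfold starts_at_origin.
        rewrite !Rmult_0_r, sin_0, cos_0.
        repeat split; field; exact HC1.
  - intros C1 C2 h1 h2 h3; split.
    + unfold h1, h2, h3; intros t.
      split; [ | split ]; auto_derive; trivial; ring.
    + apply horizontal_solution_iff.
      * unfold h1, h2; intros t.
        split; [ | split ]; auto_derive; trivial; field.
      * repeat split; ring.
Qed.
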